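(* Let $n\ge 1$ and let $k_1,\dots,k_{n-1}$ be nonnegative integers such that $k=\sum_{i=1}^{n-1} i k_i$ (the number of cyclic points) satisfies $1\le k\le n-1$. The number of prime parking functions $\pi$ of length $n$ such that $G_\pi$ has exactly $k_i$ cycles of length $i$ for every $i\in[n-1]$ is $$\frac{1}{\prod_{i=1}^{n-1} i^{k_i}k_i!}\binom{n-1}{k}k!\,k\,(n-1)^{n-k-2}.$$
   Context: $[n]=\{1,\dots,n\}$. Parking functions: there are $n$ parking spaces $1,\dots,n$ in order on a one-way street and $n$ cars $C_1,\dots,C_n$ arriving in this order; car $C_i$ has preferred space $\pi_i\in[n]$, drives to space $\pi_i$ and parks in the first available space among $\pi_i,\pi_i+1,\dots,n$ (leaving unparked if there is none). The sequence $\pi=(\pi_1,\dots,\pi_n)$ is a parking function of length $n$ if all cars are able to park. A parking function $\pi$ of length $n$ is prime if for all $1\le j\le n-1$ at least $j+1$ cars have a preference among the first $j$ spots, i.e. $|\{i:\pi_i\le j\}|\ge j+1$. The digraph $G_\pi$ has vertex set $[n]$ and edges $i\to\pi_i$. Cycles are directed cycles of $G_\pi$, with fixed points (loops) being cycles of length $1$; cyclic points are the vertices lying on cycles. *)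

(* Defs.v *)
From HB Require Import structures.
From mathcomp Require Import all_boot all_order all_algebra.
Set Implicit Arguments.
Unset Strict Implicit.
Unset Printing Implicit Defensive.

(* Both the spaces 1, ..., n and the cars C_1, ..., C_n are encoded by 'I_n,
   shifted by one: the ordinal i stands for space i + 1, resp. car C_(i+1). *)
Section Parking.
Variable n : nat.
Implicit Types (occ : {set 'I_n}) (pi : {ffun 'I_n -> 'I_n}).

Definition first_available occ (p q : 'I_n) : bool :=
  [&& p <= q, q \notin occ & [forall r : 'I_n, (p <= r < q) ==> (r \in occ)]].

(* The cars with preferences s arrive in order, the spaces in occ being
   already taken; the result is whether every one of them parks. *)
Fixpoint all_park occ (s : seq 'I_n) : bool :=
  if s is p :: s' then
    if [pick q | first_available occ p q] is Some q
    then all_park (q |: occ) s' else false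
  else true.

Definition parking_function pi : bool :=
  all_park set0 [seq pi i | i <- enum 'I_n].

(* With the shift by one, "pi_i <= j" reads [pi i < j]; j ranges over
   1, ..., n - 1. *)
Definition prime_parking_function pi : bool :=
  parking_function pi &&
  [forall j : 'I_n, (0 < j) ==> (j.+1 <= #|[set i | pi i < j]|)].

Definition pf_digraph pi : rel 'I_n := [rel i j | j == pi i].

(* A directed cycle of a digraph with all out-degrees 1 is determined by its
   vertex set, so cycles (closed walks without repeated vertices, up to
   rotation) are counted through their vertex sets. Meaningful for m > 0. *)
Definition cycles_of_length pi (m : nat) : {set {set 'I_n}} :=
  [set [set x in c] | c : m.-tuple 'I_n & ucycleb (pf_digraph pi) c].

End Parking.

(* Main.v *)
Require Import Defs.
From HB Require Import structures.
From mathcomp Require Import all_boot all_order all_algebra.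
From mathcomp Require Import perm zify ring.
Import Order.TTheory GRing.Theory Num.Theory.
Set Implicit Arguments.
Unset Strict Implicit.
Unset Printing Implicit Defensive.

(* Let m = n - 1. A prime parking function never takes the value n. Conjugating
   a map [n] -> [m] by the rotations of [m] (fixing n) preserves its cycle type
   and rotates the vector of its fibre sizes, whose sum is m + 1; by the cycle
   lemma exactly one of the m conjugates satisfies the prime inequalities, which
   by themselves imply that all cars park. So m times the required number is
   the number of maps [n] -> [m] of the given cycle type.

   Such maps are counted by removing cycles one at a time: declaring the points
   of a cycle to be roots (represented as points fixed outside the domain U)
   leaves a map with one cycle less. When no cycle is left one counts forests
   with prescribed roots: deleting the edge out of v turns a forest into a
   forest with one more root together with a target y for v which does not lie
   in the tree of v, and by symmetry all trees contain y equally often. *)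

(** * Cyclic points *)

Lemma card_in_bij (T T' : finType) (A : {set T}) (B : {set T'})
    (f : T -> T') (g : T' -> T) :
  {in A, forall x, f x \in B} -> {in B, forall y, g y \in A} ->
  {in A, cancel f g} -> {in B, cancel g f} -> #|A| = #|B|.
Proof.
move=> fAB gBA fK gK; apply/eqP; rewrite eqn_leq; apply/andP; split.
- rewrite -(card_in_imset (can_in_inj fK)); apply/subset_leq_card/subsetP.
  by move=> _ /imsetP[x xA ->]; apply: fAB.
- rewrite -(card_in_imset (can_in_inj gK)); apply/subset_leq_card/subsetP.
  by move=> _ /imsetP[x xB ->]; apply: gBA.
Qed.

Lemma fconnect_fix (V : finType) (f : V -> V) (x y : V) :
  f x = x -> fconnect f x y = (y == x).
Proof.
by move=> fx; rewrite (@fconnect_cycle _ _ [:: x]) /= ?fx ?inE ?eqxx.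
Qed.

(** The iterates of [x] must repeat, and the first one to recur lies on a cycle. Throughout,
    [fconnect f (f y) y] expresses that [y] is cyclic, since [fconnect f y y] always holds. *)
Lemma fconnect_cyclic (V : finType) (f : V -> V) (x : V) :
  exists2 y, fconnect f x y & fconnect f (f y) y.
Proof.
have /trajectP[k lt_k Ek] : iter (order f x) f x \in traject f x (order f x).
  by rewrite -[traject _ _ _]/(orbit f x) -fconnect_orbit fconnect_iter.
exists (iter k f x); first exact: fconnect_iter.
by rewrite -{2}Ek -(subnK lt_k) -[f _]iterS iterD fconnect_iter.
Qed.

Lemma eq_in_fconnect_to (V : finType) (f g : V -> V) (v y : V) :
  {in predC1 v, f =1 g} -> fconnect f y v = fconnect g y v.
Proof.
suff imp (h k : V -> V) :
    {in predC1 v, h =1 k} -> fconnect h y v -> fconnect k y v.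
  by move=> fg; apply/idP/idP; apply: imp => // x xv; rewrite fg.
move=> hk /iter_findex; move: (findex _ _ _) => m.
elim: m y => [y /= ->|m IHm y]; first exact: connect0.
case: (eqVneq y v) => [-> _|yv]; first exact: connect0.
rewrite iterSr => /IHm; rewrite hk ?inE //.
exact/connect_trans/fconnect1.
Qed.

Lemma eq_in_fcycle (V : eqType) (f g : V -> V) (p : seq V) :
  {in p, f =1 g} -> fcycle f p = fcycle g p.
Proof.
move=> fg; apply: (@eq_in_cycle _ (mem p)) => [x y xp _ /=|].
  by rewrite fg.
exact/allP.
Qed.

Lemma fcycle_cyclic (V : finType) (f : V -> V) (c : seq V) (x : V) :
  fcycle f c -> x \in c -> fconnect f (f x) x.
Proof.
move=> fc xc.
by rewrite (fconnect_cycle fc) // (eqP (next_cycle fc xc)) mem_next.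
Qed.

(** Deletes the edges out of [C], which makes its points roots. *)
Definition collapse {V : finType} (f : {ffun V -> V}) (C : {set V}) :
    {ffun V -> V} :=
  [ffun x => if x \in C then x else f x].

(** The collapsed map fixes every point of [C], so its cycle through [x] avoids [C]; off [C] it
    agrees with [f], hence this is also a cycle of [f]. *)
Lemma collapse_cyclic (V : finType) (f : {ffun V -> V}) (C : {set V}) (x : V) :
  x \notin C -> fconnect (collapse f C) (collapse f C x) x ->
  fconnect f (f x) x /\ order f x = order (collapse f C) x.
Proof.
set g := collapse f C => xC; rewrite fconnect_f => cg.
have xo : x \in orbit g x by exact: in_orbit.
have dis y : y \in orbit g x -> y \notin C.
  move=> yo; apply: contraNN xC => yC.
  have gy : g y = y by rewrite ffunE yC.
  have : fconnect g y x by rewrite (fconnect_cycle cg).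
  by rewrite fconnect_fix // => /eqP->.
have cf : fcycle f (orbit g x).
  rewrite (@eq_in_fcycle _ f g) // => y /dis yC; by rewrite ffunE (negPf yC).
split; last by rewrite (order_cycle cf) ?orbit_uniq // size_orbit.
exact: fcycle_cyclic cf xo.
Qed.

Lemma cyclic_collapse (V : finType) (f : {ffun V -> V}) (C : {set V}) (x : V) :
  {in C, forall y, ~~ fconnect f x y} -> fconnect f (f x) x ->
  fconnect (collapse f C) (collapse f C x) x /\
  order (collapse f C) x = order f x.
Proof.
set g := collapse f C => dis; rewrite fconnect_f => cf.
have xo : x \in orbit f x by exact: in_orbit.
have cg : fcycle g (orbit f x).
  rewrite (@eq_in_fcycle _ g f) // => y yo; rewrite ffunE.
  by case: ifP => // /dis; rewrite fconnect_orbit yo.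
split; last by rewrite (order_cycle cg) ?orbit_uniq // size_orbit.
exact: fcycle_cyclic cg xo.
Qed.

(** For a cyclic point, [order f x] is the length of its cycle. The restriction to [U] keeps roots,
    which are fixed points outside [U], from counting as loops. *)
Definition cyclic_points {V : finType} (f : V -> V) (U : {set V}) (i : nat) :
    {set V} :=
  [set x in U | fconnect f (f x) x && (order f x == i)].

Lemma cyclic_points_collapse (V : finType) (f : {ffun V -> V}) (U : {set V})
    (c : seq V) (j : nat) :
  fcycle f c ->
  cyclic_points (collapse f [set x in c]) (U :\: [set x in c]) j =
  cyclic_points f U j :\: [set x in c].
Proof.
move=> fc; apply/setP => x; rewrite !inE; case: (boolP (x \in c)) => //= xc.
case: (x \in U) => //=; apply/andP/andP => -[cx /eqP ox].
  case: (collapse_cyclic _ cx); first by rewrite inE.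
  by move=> -> ->; rewrite ox eqxx.
case: (cyclic_collapse (C := [set x in c]) _ cx); last first.
  by move=> -> ->; rewrite ox eqxx.
move=> y; rewrite inE => yc; apply: contraNN xc => xy.
move: cx; rewrite fconnect_f => cx.
rewrite -(fconnect_cycle fc yc).
have yo : y \in orbit f x by rewrite -fconnect_orbit.
by rewrite (fconnect_cycle cx yo) in_orbit.
Qed.

Definition conj_fun {V : finType} (p : {perm V}) (f : {ffun V -> V}) :
    {ffun V -> V} :=
  [ffun x => p (f ((p^-1)%g x))].

Lemma conj_funE (V : finType) (p : {perm V}) (f : {ffun V -> V}) (x : V) :
  conj_fun p f (p x) = p (f x).
Proof. by rewrite ffunE permK. Qed.

Lemma conj_funK (V : finType) (p : {perm V}) :
  cancel (conj_fun p) (conj_fun p^-1%g).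
Proof. by move=> f; apply/ffunP => x; rewrite !ffunE invgK !permK. Qed.

Lemma conj_funVK (V : finType) (p : {perm V}) :
  cancel (conj_fun p^-1%g) (conj_fun p).
Proof. by move=> f; apply/ffunP => x; rewrite !ffunE invgK !permKV. Qed.

Lemma fconnect_conj (V : finType) (p : {perm V}) (f : {ffun V -> V}) (x y : V) :
  fconnect (conj_fun p f) (p x) (p y) = fconnect f x y.
Proof.
have itE k : iter k (conj_fun p f) (p x) = p (iter k f x).
  by elim: k => //= k ->; rewrite conj_funE.
apply/idP/idP => /iter_findex; last by move<-; rewrite -itE fconnect_iter.
by rewrite itE => /perm_inj <-; rewrite fconnect_iter.
Qed.

Lemma order_conj (V : finType) (p : {perm V}) (f : {ffun V -> V}) (x : V) :
  order (conj_fun p f) (p x) = order f x.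
Proof.
rewrite /order -(card_image (@perm_inj _ p) (fconnect f x)).
apply: eq_card => y.
rewrite -[y](permKV p) mem_image; last exact: perm_inj.
by rewrite [LHS]fconnect_conj.
Qed.

Lemma cyclic_points_conj (V : finType) (p : {perm V}) (f : {ffun V -> V})
    (U : {set V}) (i : nat) :
  cyclic_points (conj_fun p f) (p @: U) i = p @: cyclic_points f U i.
Proof.
apply/setP => y; rewrite -[y](permKV p); move: ((p^-1)%g y) => x.
rewrite mem_imset ?inE; last exact: perm_inj.
rewrite mem_imset; last exact: perm_inj.
by rewrite conj_funE fconnect_conj order_conj.
Qed.

(** * Forests with prescribed roots *)

(** Maps from [U] to [W], extended by the identity so that they can be iterated. The points of
    [W :\: U] serve as roots. *)
Definition maps {V : finType} (W U : {set V}) : {set {ffun V -> V}} :=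
  [set f : {ffun V -> V} |
    [forall x, f x \in (if x \in U then W else [set x])]].

Lemma mapsP (V : finType) (W U : {set V}) (f : {ffun V -> V}) :
  reflect ({in U, forall x, f x \in W} /\ {in ~: U, forall x, f x = x})
          (f \in maps W U).
Proof.
rewrite inE; apply: (iffP forallP) => [fP|[fW fU] x].
  by split=> x; move: (fP x); rewrite ?inE; case: (x \in U) => // /set1P.
by case: ifPn => xU; [apply: fW | rewrite fU ?inE].
Qed.

Lemma card_maps (V : finType) (W U : {set V}) : #|maps W U| = (#|W| ^ #|U|)%N.
Proof.
have -> : #|maps W U| =
    #|family (fun x : V => mem (if x \in U then W else [set x]))|.
  by apply: eq_card => f; rewrite inE.
rewrite card_family foldrE big_map big_enum /= (bigID (mem U)) /=.
rewrite [X in (_ * X)%N]big1 ?muln1; last first.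
  by move=> x /negPf->; rewrite cards1.
by rewrite -prod_nat_const; apply: eq_bigr => x ->.
Qed.

Definition acyclic_maps {V : finType} (W U : {set V}) : {set {ffun V -> V}} :=
  [set f in maps W U | [forall x in U, ~~ fconnect f (f x) x]].

Lemma acyclic_mapsP (V : finType) (W U : {set V}) (f : {ffun V -> V}) :
  reflect (f \in maps W U /\ {in U, forall x, ~~ fconnect f (f x) x})
          (f \in acyclic_maps W U).
Proof.
rewrite [f \in acyclic_maps _ _]inE.
by apply: (iffP andP) => -[fm /forall_inP fa].
Qed.

Lemma fconnect_maps (V : finType) (W U : {set V}) (f : {ffun V -> V})
    (x y : V) :
  f \in maps W U -> x \in W -> fconnect f x y -> y \in W.
Proof.
move=> /mapsP[fW fU] xW /iter_findex <-; elim: (findex _ _ _) => //= k IHk.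
by case: (boolP (iter k f x \in U)) => [/fW // | ?]; rewrite fU ?inE.
Qed.

(** The edge out of [v] closes a cycle exactly when [f v] leads back to [v]. A path to [v] does not
    need that edge, so this can be tested in the collapsed map. *)
Lemma collapse1_acyclic (V : finType) (W U : {set V}) (v : V)
    (f : {ffun V -> V}) :
  v \in U -> f v \in W ->
  (f \in acyclic_maps W U) =
  (collapse f [set v] \in acyclic_maps W (U :\ v))
    && ~~ fconnect (collapse f [set v]) (f v) v.
Proof.
set g := collapse f _ => vU fvW.
have gE x : x != v -> g x = f x by rewrite ffunE inE => /negPf->.
have gv : g v = v by rewrite ffunE inE eqxx.
have fg : fconnect f (f v) v = fconnect g (f v) v.
  by apply: eq_in_fconnect_to => x xv; rewrite gE.
have mfg : (f \in maps W U) = (g \in maps W (U :\ v)).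
  apply/mapsP/mapsP => -[fW fU]; split=> x; rewrite ?inE.
  - by case/andP=> xv xU; rewrite gE // fW.
  - rewrite negb_and negbK; case: eqVneq => [->//|xv /= xU].
    by rewrite gE // fU ?inE.
  - move=> xU; case: (eqVneq x v) => [->//|xv]; rewrite -gE //.
    by apply: fW; rewrite !inE xv.
  - move=> xU; have xv : x != v by apply: contraNneq xU => ->.
    by rewrite -gE //; apply: fU; rewrite !inE negb_and xU orbT.
apply/acyclic_mapsP/andP => [[fm fa]|[/acyclic_mapsP[gm ga]]].
  split; last by rewrite -fg fa.
  apply/acyclic_mapsP; split; first by rewrite -mfg.
  move=> x; rewrite !inE => /andP[xv xU]; apply: contra (fa x xU).
  by case/collapse_cyclic; rewrite ?inE.
rewrite -fg => fv; split; first by rewrite mfg.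
move=> x xU; apply/negP => cx; case: (boolP (fconnect f x v)) => xv.
  move: cx fv; rewrite !fconnect_f => cx; rewrite fconnect_orbit in xv.
  by rewrite (cycle_orbit_cycle cx xv).
have [|cg _] := @cyclic_collapse _ f [set v] x _ cx.
  by move=> y /set1P->.
move: (ga x); rewrite !inE xU cg andbT => /(_ _)/negP; apply => //.
by apply: contraNneq xv => ->; exact: connect0.
Qed.

Lemma card_acyclic_maps_step (V : finType) (W U : {set V}) (v : V) :
  v \in U ->
  #|acyclic_maps W U| =
  #|[set p in setX (acyclic_maps W (U :\ v)) W | ~~ fconnect p.1 p.2 v]|.
Proof.
move=> vU.
pose F (f : {ffun V -> V}) := (collapse f [set v], f v).
pose G (g : {ffun V -> V}) y : {ffun V -> V} :=
  [ffun x => if x == v then y else g x].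
have GK (g : {ffun V -> V}) y : g v = v -> collapse (G g y) [set v] = g.
  by move=> gv; apply/ffunP => x; rewrite !ffunE inE; case: eqVneq => [->|].
have Gv g y : G g y v = y by rewrite ffunE eqxx.
have fixv (g : {ffun V -> V}) : g \in acyclic_maps W (U :\ v) -> g v = v.
  by case/acyclic_mapsP => /mapsP[_ ->]; rewrite ?inE ?eqxx.
apply: (@card_in_bij _ _ _ _ F (fun p => G p.1 p.2)).
- move=> f fA; have fvW : f v \in W by case/acyclic_mapsP: fA => /mapsP[->].
  by rewrite inE in_setX /= fvW andbT -collapse1_acyclic.
- move=> [g y]; rewrite inE in_setX /= => /andP[/andP[gA yW] gy].
  by rewrite (collapse1_acyclic vU) Gv // GK ?gA // fixv.
- by move=> f _; apply/ffunP => x; rewrite !ffunE inE /=; case: eqVneq => [->|].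
- move=> [g y]; rewrite inE in_setX /= => /andP[/andP[gA _] _].
  by rewrite /F Gv GK // fixv.
Qed.

(** Every point of [W] lies in exactly one tree: its iterates reach a cyclic point, which can only
    be a root. *)
Lemma acyclic_maps_root (V : finType) (W U : {set V}) (g : {ffun V -> V})
    (y : V) :
  g \in acyclic_maps W U -> y \in W ->
  (\sum_(r in W :\: U) fconnect g y r = 1)%N.
Proof.
move=> /acyclic_mapsP[gm ga] yW.
have [r yr cr] := fconnect_cyclic g y.
have rU : r \notin U by apply: contraTN cr => /ga.
have rW : r \in W by apply: fconnect_maps gm yW yr.
have gU z : z \notin U -> g z = z by case/mapsP: gm => _ gU zU; rewrite gU ?inE.
rewrite (bigD1 r) /= ?inE ?rU ?rW // yr big1 // => z.
rewrite !inE => /andP[/andP[zU zW] zr]; case: (boolP (fconnect g y z)) => // yz.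
case/eqP: zr; move/iter_findex: yr => yr; move/iter_findex: yz => yz.
(* Both [r] and [z] are fixed and reached from [y], so iterating for the sum of the two step counts
   yields each of them. *)
rewrite -(iter_fix (findex g y r) (gU z zU)) -{1}yz -iterD addnC iterD yr.
by rewrite iter_fix ?gU.
Qed.

Lemma conj_maps (V : finType) (p : {perm V}) (W U : {set V})
    (f : {ffun V -> V}) :
  (conj_fun p f \in maps (p @: W) (p @: U)) = (f \in maps W U).
Proof.
rewrite !inE; apply/forallP/forallP => fP x.
  move: (fP (p x)); rewrite conj_funE mem_imset; last exact: perm_inj.
  by case: ifP => _; rewrite ?inE ?(inj_eq perm_inj) // mem_imset //;
  apply: perm_inj.
rewrite -[x](permKV p) conj_funE mem_imset; last exact: perm_inj.
move: (fP ((p^-1)%g x)).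
by case: ifP => _; rewrite ?inE ?(inj_eq perm_inj) // mem_imset //;
  apply: perm_inj.
Qed.

Lemma conj_acyclic_maps (V : finType) (p : {perm V}) (W U : {set V})
    (f : {ffun V -> V}) :
  (conj_fun p f \in acyclic_maps (p @: W) (p @: U)) = (f \in acyclic_maps W U).
Proof.
rewrite [LHS]inE [RHS]inE conj_maps; congr (_ && _).
apply/forall_inP/forall_inP => fP x xU.
  by move: (fP (p x)); rewrite conj_funE fconnect_conj; apply; apply: imset_f.
case/imsetP: xU => y yU ->.
by rewrite conj_funE fconnect_conj fP.
Qed.

(** Conjugation by the transposition of two roots permutes the forests and exchanges the trees at
    these roots. *)
Lemma card_rooted_at (V : finType) (W U : {set V}) (r v : V) :
  r \in W :\: U -> v \in W :\: U ->
  #|[set p in setX (acyclic_maps W U) W | fconnect p.1 p.2 r]| =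
  #|[set p in setX (acyclic_maps W U) W | fconnect p.1 p.2 v]|.
Proof.
suff le a b : a \in W :\: U -> b \in W :\: U ->
    #|[set p in setX (acyclic_maps W U) W | fconnect p.1 p.2 a]| <=
    #|[set p in setX (acyclic_maps W U) W | fconnect p.1 p.2 b]|.
  by move=> rR vR; apply/eqP; rewrite eqn_leq !le.
move=> /setDP[aW aU] /setDP[bW bU]; set t := tperm a b.
have tW : t @: W = W.
  apply: im_perm_on; apply: subset_trans (tperm_on a b) _.
  by apply/subsetP => x /set2P[]->.
have tU : t @: U = U.
  rewrite -[RHS]imset_id; apply: eq_in_imset => x xU; rewrite /t tpermD //.
    by apply: contraNneq aU => ->.
  by apply: contraNneq bU => ->.
pose F (p : {ffun V -> V} * V) := (conj_fun t p.1, t p.2).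
have F_inj : injective F.
  by move=> [g y] [h z] [/(can_inj (conj_funK t)) -> /perm_inj ->].
rewrite -(card_imset _ F_inj); apply/subset_leq_card/subsetP.
move=> _ /imsetP[[g y] gP ->]; move: gP; rewrite !(inE, in_setX) /=.
rewrite -[b](tpermL a b) fconnect_conj => /andP[/andP[gA yW] ->].
rewrite andbT -{2}tW imset_f // andbT.
have := conj_acyclic_maps t W U g.
by rewrite tW tU !inE gA.
Qed.

(** The factor [#|W|] on the left avoids the exponent [#|U| - 1]. The induction is on the number of
    non-roots that can be targets. *)
Lemma card_acyclic_maps (V : finType) (W U : {set V}) :
  (#|acyclic_maps W U| * #|W| = #|W :\: U| * #|W| ^ #|U|)%N.
Proof.
move Em: #|U :&: W| => m; elim: m U Em => [|m IHm] U Em.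
  (* No edge leads into [U], so every map is acyclic. *)
  move/cards0_eq: Em => UW.
  have dUW x : x \in U -> x \notin W.
    by move=> xU; apply/negP => xW; move/setP/(_ x): UW; rewrite !inE xU xW.
  have -> : acyclic_maps W U = maps W U.
    apply/setP => f; rewrite [LHS]inE; apply: andb_idr => fm.
    apply/forall_inP => x xU; apply: contra (dUW x xU) => fx.
    by apply: (fconnect_maps fm _ fx); case/mapsP: fm => ->.
  have -> : W :\: U = W.
    apply/setP => x; rewrite inE.
    by case: (boolP (x \in U)) => // /dUW /negPf->.
  by rewrite card_maps mulnC.
have [v] : exists v, v \in U :&: W by apply/card_gt0P; rewrite Em.
rewrite inE => /andP[vU vW]; set U' := U :\ v.
have /IHm {}IHm : #|U' :&: W| = m.
  apply: succn_inj; rewrite -Em (cardsD1 v (U :&: W)) inE vU vW add1n.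
  by congr (#|pred_of_set _|.+1); apply/setP => x; rewrite !inE andbA.
have vU' : v \notin U' by rewrite !inE eqxx.
have Es : #|W :\: U'| = #|W :\: U|.+1.
  rewrite (cardsD1 v) !inE eqxx vW /= add1n; congr (#|pred_of_set _|.+1).
  apply/setP => x; rewrite !inE; case: eqVneq => [->|//]; by rewrite vU.
have EU : #|U| = #|U'|.+1 by rewrite (cardsD1 v U) vU add1n.
(* [X r] counts pairs of a forest and a point of [W] in the tree of [r]. Each pair belongs to one
   tree and all trees contribute equally, which determines [X v], the number of forbidden choices
   for the edge out of [v]. *)
pose X r := #|[set p in setX (acyclic_maps W U') W | fconnect p.1 p.2 r]|.
have XE r : r \in W :\: U' -> X r = X v.
  by move=> rR; apply: card_rooted_at; rewrite // inE vU' vW.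
have sumX : (\sum_(r in W :\: U') X r = #|acyclic_maps W U'| * #|W|)%N.
  rewrite -cardsX -sum1_card.
  transitivity (\sum_(r in W :\: U') \sum_(p in setX (acyclic_maps W U') W)
      fconnect p.1 p.2 r)%N.
    apply: eq_bigr => r _; rewrite /X -sum1dep_card big_mkcondr /=.
    by apply: eq_bigr => p _; case: ifP.
  rewrite exchange_big; apply: eq_bigr => -[g y].
  rewrite in_setX => /andP[gA yW].
  exact: acyclic_maps_root gA yW.
have split_v : (X v + #|acyclic_maps W U| = #|acyclic_maps W U'| * #|W|)%N.
  rewrite (card_acyclic_maps_step W vU) -cardsX.
  rewrite -[RHS](cardsID [set p : {ffun V -> V} * V | fconnect p.1 p.2 v]).
  by congr (_ + _)%N; apply: eq_card => p; rewrite !inE // andbC.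
move: sumX; rewrite (eq_bigr _ XE) sum_nat_const Es.
have w0 : 0 < #|W| by apply/card_gt0P; exists v.
rewrite EU expnS; move: split_v; rewrite IHm Es; nia.
Qed.

(** * Maps of given cycle type *)

(** The cycle type is read off the points: [ks i] cycles of length [i] have [i * ks i] points. Only
    the lengths [0 < i < n] are constrained. *)
Definition maps_of_type {V : finType} (W U : {set V}) (n : nat)
    (ks : nat -> nat) : {set {ffun V -> V}} :=
  [set f in maps W U |
    [forall i : 'I_n, (0 < i) ==> (#|cyclic_points f U i| == (i * ks i)%N)]].

Lemma maps_of_typeP (V : finType) (W U : {set V}) (n : nat) (ks : nat -> nat)
    (f : {ffun V -> V}) :
  reflect (f \in maps W U /\
           forall i, 0 < i < n -> #|cyclic_points f U i| = (i * ks i)%N)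
          (f \in maps_of_type W U n ks).
Proof.
rewrite [f \in maps_of_type _ _ _ _]inE.
apply: (iffP andP) => -[fm fc]; split=> //.
  move=> i /andP[i0 ilt]; move/forallP/(_ (Ordinal ilt)): fc.
  by rewrite /= i0 => /eqP.
by apply/forallP => i; apply/implyP => i0; rewrite fc // i0 ltn_ord.
Qed.

(** A cycle meeting [U] lies in [W], so its length is below [n] and is seen by the type. *)
Lemma maps_of_type0 (V : finType) (W U : {set V}) (n : nat) (ks : nat -> nat) :
  #|W| < n -> (forall i, 0 < i < n -> ks i = 0) ->
  maps_of_type W U n ks = acyclic_maps W U.
Proof.
move=> Wn ks0; apply/setP => f; apply/maps_of_typeP/acyclic_mapsP => -[fm fc].
  split=> // x xU; apply/negP => cx.
  have fxW : f x \in W by case/mapsP: fm => ->.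
  have oW : order f x <= #|W|.
    apply/subset_leq_card/subsetP => y xy.
    by apply: (fconnect_maps fm fxW); apply: connect_trans cx xy.
  have oP : 0 < order f x < n by rewrite order_gt0 (leq_ltn_trans oW Wn).
  move: (fc _ oP); rewrite ks0 // muln0 => /cards0_eq/setP/(_ x).
  by rewrite !inE xU cx eqxx.
split=> // i iP; rewrite ks0 // muln0; apply/eqP; rewrite cards_eq0.
by apply/eqP/setP => x; rewrite !inE; apply/and3P => -[/fc/negP].
Qed.

(** A cyclic point corresponds to the listing of its cycle that starts there. *)
Lemma card_cyclic_points (V : finType) (W U : {set V}) (f : {ffun V -> V})
    (i : nat) :
  f \in maps W U -> 0 < i ->
  #|cyclic_points f U i| =
  #|[set c : i.-tuple V | (all (mem (U :&: W)) c && uniq c) && fcycle f c]|.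
Proof.
case: i => // i fm _.
apply: (@card_in_bij _ _ _ _
  (fun x => Tuple (introT eqP (size_traject f x i.+1))) (@thead i V)).
- move=> x; rewrite !inE => /and3P[xU cx /eqP ox].
  have Eo : traject f x i.+1 = orbit f x by rewrite /orbit ox.
  have fxW : f x \in W by case/mapsP: fm => ->.
  rewrite [tval _]Eo orbit_uniq -fconnect_f cx !andbT.
  apply/allP => y; rewrite -fconnect_orbit => xy /=.
  rewrite inE (fconnect_maps fm fxW) ?andbT; last exact: connect_trans cx xy.
  apply: contraT => yU.
  have fy : f y = y by case/mapsP: fm => _ ->; rewrite ?inE.
  have : fconnect f y x.
    move: cx; rewrite fconnect_f => cx; rewrite fconnect_orbit in xy.
    by rewrite (fconnect_cycle cx xy) in_orbit.
  by rewrite fconnect_fix // => /eqP xE; rewrite -xE xU in yU.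
- move=> c; rewrite !inE => /andP[/andP[/allP cU uc] fc].
  have cc : thead c \in c by rewrite /thead mem_tnth.
  have := cU _ cc; rewrite !inE => /andP[-> _] /=.
  rewrite (order_cycle fc) // size_tuple eqxx andbT.
  exact: fcycle_cyclic fc cc.
- by move=> x _; rewrite /thead (tnth_nth x).
- move=> c; rewrite inE => /andP[_ fc]; apply/val_inj => /=.
  move: fc; case: c => -[|x c] //= sc fc.
  by rewrite /thead (tnth_nth x) /= (fcycle_consE fc) (eqP sc).
Qed.

Lemma card_cyclic_points_collapse (V : finType) (U : {set V})
    (f : {ffun V -> V}) (c : seq V) (j : nat) :
  fcycle f c -> uniq c -> {subset c <= U} ->
  #|cyclic_points f U j| =
  (#|cyclic_points (collapse f [set x in c]) (U :\: [set x in c]) j|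
     + (j == size c) * size c)%N.
Proof.
move=> fc uc cU; rewrite cyclic_points_collapse // addnC.
rewrite -(cardsID [set x in c] (cyclic_points f U j)); congr (_ + _)%N.
case: eqVneq => [->|jc].
  rewrite mul1n -(card_uniqP uc); apply: eq_card => x; rewrite !inE.
  case: (boolP (x \in c)) => xc; rewrite ?andbF // cU //=.
  rewrite (fcycle_cyclic fc xc) /=.
  by rewrite (order_cycle fc) // (card_uniqP uc) eqxx.
apply/eqP; rewrite cards_eq0; apply/eqP/setP => x; rewrite !inE.
apply/negP => /andP[/and3P[_ _ /eqP ox] xc].
by rewrite -ox (order_cycle fc) // eqxx in jc.
Qed.

(** Collapsing [c] loses only the edges inside [c], and these are restored by [next c]. *)
Lemma card_maps_of_type_cycle (V : finType) (W U : {set V}) (n : nat)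
    (ks : nat -> nat) (c : seq V) :
  uniq c -> {subset c <= U :&: W} -> 0 < size c < n -> 0 < ks (size c) ->
  #|[set f in maps_of_type W U n ks | fcycle f c]| =
  #|maps_of_type W (U :\: [set x in c]) n (fun j => ks j - (j == size c))%N|.
Proof.
move=> uc cUW cn ksc; have cU : {subset c <= U} by move=> x /cUW /setIP[].
set C := [set x in c]; set ks' := (fun j => ks j - (j == size c))%N.
pose G (h : {ffun V -> V}) : {ffun V -> V} :=
  [ffun x => if x \in c then next c x else h x].
have Gc (h : {ffun V -> V}) : fcycle (G h) c.
  rewrite (@eq_in_fcycle _ _ (next c)); first exact: cycle_next.
  by move=> x xc; rewrite ffunE xc.
have fmC (f : {ffun V -> V}) : fcycle f c ->
    (collapse f C \in maps W (U :\: C)) = (f \in maps W U).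
  move=> fc; apply/mapsP/mapsP => -[fW fU]; split=> x xP.
  - case: (boolP (x \in c)) => xc.
      rewrite (eqP (next_cycle fc xc)).
      by have /cUW/setIP[] : next c x \in c by rewrite mem_next.
    by move: (fW x); rewrite ffunE !inE (negPf xc) /=; apply.
  - have xc : x \notin c by apply: contraTN xP => /cU; rewrite inE negbK.
    move: (fU x); rewrite ffunE !inE (negPf xc) /=; apply.
    by move: xP; rewrite inE.
  - move: xP; rewrite !inE => /andP[xc xU]; rewrite ffunE inE (negPf xc).
    exact: fW.
  - rewrite ffunE inE; case: ifPn => // xc; apply: fU.
    by move: xP; rewrite !inE xc.
have fC (f : {ffun V -> V}) : fcycle f c -> (f \in maps_of_type W U n ks) =
    (collapse f C \in maps_of_type W (U :\: C) n ks').
  move=> fc; apply/maps_of_typeP/maps_of_typeP => -[fm fk].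
    split=> [|i iP]; first by rewrite fmC.
    move: (fk i iP); rewrite (card_cyclic_points_collapse _ fc) //.
    rewrite /ks'; case: eqVneq => [->|_];
      rewrite ?subn0 ?mul1n ?mul0n ?addn0 ?mulnBr ?muln1 //.
    by move<-; rewrite addnK.
  split=> [|i iP]; first by rewrite -fmC.
  rewrite (card_cyclic_points_collapse _ fc) // fk //.
  rewrite /ks'; case: eqVneq => [->|_];
    rewrite ?subn0 ?mul1n ?mul0n ?addn0 ?mulnBr ?muln1 //.
  by rewrite subnK // leq_pmulr.
have GK (h : {ffun V -> V}) : {in C, forall x, h x = x} -> collapse (G h) C = h.
  move=> hC; apply/ffunP => x; rewrite !ffunE inE.
  by case: (boolP (x \in c)) => // xc; rewrite hC // inE.
have hK (h : {ffun V -> V}) : h \in maps_of_type W (U :\: C) n ks' ->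
    collapse (G h) C = h.
  case/maps_of_typeP => /mapsP[_ hU] _; apply: GK => x xC; apply: hU.
  by rewrite !inE; move: xC; rewrite inE => ->.
apply: (@card_in_bij _ _ _ _ (fun f => collapse f C) G).
- by move=> f; rewrite inE => /andP[fM fc]; rewrite -fC.
- by move=> h hM; rewrite inE fC ?Gc // hK // hM.
- move=> f; rewrite inE => /andP[_ fc]; apply/ffunP => x; rewrite !ffunE inE.
  by case: (boolP (x \in c)) => // xc; rewrite (eqP (next_cycle fc xc)).
- exact: hK.
Qed.

Lemma ffactnDr (n i j : nat) : (n ^_ (i + j) = n ^_ i * (n - i) ^_ j)%N.
Proof.
elim: j => [|j IHj]; first by rewrite addn0 ffactn0 muln1.
by rewrite addnS !ffactnSr IHj subnDA mulnA.
Qed.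

(** Double counting of the pairs of a map and a listing [c] of one of its [i]-cycles: each map has
    [i * ks i] listings, and each possible [c] occurs in [N] maps. *)
Lemma card_maps_of_type_step (V : finType) (W U : {set V}) (n i : nat)
    (ks : nat -> nat) (N : nat) :
  0 < i < n -> 0 < ks i ->
  (forall c : i.-tuple V, uniq c -> {subset c <= U :&: W} ->
    #|maps_of_type W (U :\: [set x in c]) n
        (fun j => ks j - (j == i))%N| = N) ->
  (#|maps_of_type W U n ks| * (i * ks i) = #|U :&: W| ^_ i * N)%N.
Proof.
move=> iP ksi cN; have [i0 _] := andP iP.
pose Q (c : i.-tuple V) := all (mem (U :&: W)) c && uniq c.
rewrite -sum_nat_const -[in RHS]card_uniq_tuples -sum_nat_const.
transitivity (\sum_(f in maps_of_type W U n ks)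
    \sum_(c : i.-tuple V | Q c) (fcycle f c : nat))%N.
  apply: eq_bigr => f /maps_of_typeP[fm <-] //.
  rewrite (card_cyclic_points fm i0) -sum1dep_card big_mkcondr /=.
  by apply: eq_bigr => c _; case: ifP.
rewrite exchange_big /=; apply: eq_big => [c|c /andP[/allP cUW uc]].
  by rewrite inE.
have := @card_maps_of_type_cycle _ W U n ks c uc cUW.
rewrite size_tuple cN // => <- //.
rewrite -sum1dep_card big_mkcondr /=.
by apply: eq_bigr => f _; case: ifP.
Qed.

(** Induction on the number [k] of cyclic points, removing one cycle of some length [i]; without
    cycles this is the forest count. *)
Lemma card_maps_of_type (V : finType) (W U : {set V}) (n : nat)
    (ks : nat -> nat) (k := \sum_(i < n | 0 < i) i * ks i) :
  #|W| < n ->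
  (#|maps_of_type W U n ks| * (\prod_(i < n | 0 < i) (i ^ ks i * (ks i)`!))
    * #|W|
    = #|U :&: W| ^_ k * (#|W :\: U| + k) * #|W| ^ (#|U| - k))%N.
Proof.
move=> Wn; rewrite {}/k; move Ek: (\sum_(i < n | 0 < i) i * ks i)%N => k.
elim/ltn_ind: k U ks Ek => k IHk U ks Ek.
case: (boolP [forall i : 'I_n, (0 < i) ==> (ks i == 0)]) => [/forallP ks0|].
  have {}ks0 i : 0 < i < n -> ks i = 0.
    by case/andP=> i0 ilt; move: (ks0 (Ordinal ilt)); rewrite /= i0 => /eqP.
  have k0 : k = 0 by rewrite -Ek big1 // => i i0; rewrite ks0 ?muln0 ?i0 /=.
  rewrite maps_of_type0 // big1 ?muln1 => [|i i0]; last by rewrite ks0 ?i0 /=.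
  by rewrite card_acyclic_maps k0 ffactn0 mul1n addn0 subn0.
rewrite negb_forall => /existsP[i]; rewrite negb_imply -lt0n => /andP[i0 ksi].
pose ks' (j : nat) := (ks j - (j == i))%N.
have ks'i (j : 'I_n) : j != i -> ks' j = ks j.
  by rewrite /ks' -val_eqE => /negPf->; rewrite subn0.
have Ei : ks i = (ks' i).+1 by rewrite /ks' eqxx subn1 prednK.
pose k' := (\sum_(j < n | 0 < j) j * ks' j)%N.
have kE : k = (i + k')%N.
  rewrite -Ek /k' (bigD1 i) //= [in RHS](bigD1 i) //= Ei mulnS addnA.
  by congr (_ + _)%N; apply: eq_bigr => j /andP[_ ji]; rewrite ks'i.
pose P := (\prod_(j < n | 0 < j) (j ^ ks j * (ks j)`!))%N.
pose P' := (\prod_(j < n | 0 < j) (j ^ ks' j * (ks' j)`!))%N.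
have PE : P = (i * ks i * P')%N.
  rewrite /P /P' (bigD1 i) //= [in RHS](bigD1 i) //= Ei expnS factS.
  rewrite (eq_bigr (fun j : 'I_n => j ^ ks' j * (ks' j)`!)%N); first by ring.
  by move=> j /andP[_ ji]; rewrite ks'i.
pose w := #|W|.
have [w0|w0] := posnP w.
  have /cards0_eq -> : #|W| = 0 by [].
  rewrite cards0 muln0 setI0 cards0 ffact_small ?mul0n // kE.
  by rewrite addn_gt0 i0.
have P'0 : 0 < P'.
  by apply: prodn_cond_gt0 => j j0; rewrite muln_gt0 expn_gt0 j0 fact_gt0.
(* The value given by induction after the removal of a cycle: [i] points leave [U] and, being in
   [W], become roots. *)
pose A := ((#|U :&: W| - i) ^_ k' *
  (#|W :\: U| + i + k') * w ^ (#|U| - i - k'))%N.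
have EN c : uniq c -> size c = i -> {subset c <= U :&: W} ->
    (#|maps_of_type W (U :\: [set x in c]) n ks'| * P' * w)%N = A.
  move=> uc sc cUW.
  have Cc : #|[set x in c]| = i by rewrite cardsE (card_uniqP uc).
  have CUW : [set x in c] \subset U :&: W.
    by apply/subsetP => x; rewrite inE => /cUW.
  have /subsetIP[CU CW] := CUW.
  have k'k : k' < k by rewrite kE -[X in X < _]add0n ltn_add2r.
  rewrite (IHk k' k'k _ ks' erefl) /A; congr (_ ^_ _ * (_ + _) * _ ^ (_ - _))%N.
  - rewrite -[in RHS]Cc -[in RHS](setIidPr CUW) -cardsD; apply: eq_card => x.
    by rewrite !inE; case: (x \in c).
  - rewrite -[in RHS]Cc -(cardsID [set x in c] (W :\: (U :\: [set x in c]))) addnC.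
    congr (_ + _)%N; apply: eq_card => x; move: (cUW x); rewrite !inE.
      by case: (x \in c) => [/(_ isT)/andP[-> _]|_].
    by case: (x \in c) => [/(_ isT)/andP[-> ->]|_]; rewrite ?andbF.
  - by rewrite -Cc -[in RHS](setIidPr CU) -cardsD.
(* Dividing [A] gives a value visibly independent of [c]; the division is exact as soon as some [c]
   exists. *)
pose N := (A %/ (P' * w))%N.
have NE c : uniq c -> size c = i -> {subset c <= U :&: W} ->
    #|maps_of_type W (U :\: [set x in c]) n ks'| = N.
  by move=> uc sc cUW; rewrite /N -(EN c) // -mulnA mulnK // muln_gt0 P'0.
have step : (#|maps_of_type W U n ks| * (i * ks i) = #|U :&: W| ^_ i * N)%N.
  apply: card_maps_of_type_step; rewrite ?i0 ?ltn_ord //.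
  by move=> c uc cUW; rewrite -(NE c) // size_tuple.
have NA : (#|U :&: W| ^_ i * N * P' * w = #|U :&: W| ^_ i * A)%N.
  (* If [i] is too large, both sides vanish; otherwise a concrete [c] shows that the division is
     exact. *)
  have [ui|] := leqP i #|U :&: W|; last by move/ffact_small->.
  have [c [uc sc cUW]] : exists c : seq V,
      [/\ uniq c, size c = i & {subset c <= U :&: W}].
    exists (take i (enum (U :&: W))); split.
    - by rewrite take_uniq // enum_uniq.
    - by rewrite size_takel // -cardE.
    - by move=> x /mem_take; rewrite mem_enum.
  by rewrite -!mulnA; congr (_ * _)%N; rewrite mulnA -(NE c) // EN.
rewrite -/P PE -/w !mulnA -[in LHS](mulnA _ (nat_of_ord i)) step NA.
by rewrite /A kE ffactnDr subnDA !mulnA addnA.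
Qed.

(** * Rotations and the prime condition *)

(** [G] is to be read as the partial sums of an [m]-periodic sequence whose sum over a period is
    [m.+1]. *)
Lemma cycle_lemma (m : nat) (G : nat -> nat) :
  0 < m -> (forall N, G (N + m) = G N + m.+1)%N ->
  (\sum_(b < m)
     [forall j : 'I_m.+1, (0 < j) ==> (G b + j < G (b + j))%N] = 1)%N.
Proof.
move=> m0 Gm.
(* K is periodic, and a minimum b of K is the required starting point. *)
pose K (i : nat) : int := ((m * G i)%:Z - (m.+1 * i)%:Z)%R.
have Kmod i : K (i %% m)%N = K i.
  rewrite [in RHS](divn_eq i m); elim: (i %/ m) => [|q IHq] //.
  by rewrite IHq mulSn -addnA [in RHS]addnC /K Gm; nia.
pose b : 'I_m := [arg min_(i < Ordinal m0) K i]%O.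
have Kb i : (K b <= K i)%R.
  rewrite -(Kmod i) /b; case: Order.TotalTheory.arg_minP => // c _.
  by move/(_ (Ordinal (ltn_pmod i m0))); apply.
rewrite (bigD1 b) //= big1 ?addn0 => [|c cb].
  apply/eqP; rewrite eqb1; apply/forallP => j; apply/implyP => j0.
  (* Minimality gives [m * (G (b + j) - G b) >= m.+1 * j > m * j]. *)
  by move: (Kb (b + j)%N); rewrite /K; nia.
apply/eqP; rewrite eqb0; apply/negP => /forallP cP.
have {}cP j : 0 < j <= m -> G c + j < G (c + j).
  by case/andP=> j0 jm; move/implyP: (cP (@Ordinal m.+1 j jm)); apply.
have bP j : 0 < j <= m -> G b + j < G (b + j).
  by move=> jP; move: (Kb (b + j)%N); rewrite /K; nia.
have := Gm c; have := Gm b.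
(* Two good starting points would cut a period into two arcs, each gaining more than its length, so
   at least [m + 2] in total. *)
case: (ltngtP b c) => [bc|bc|/val_inj bc]; last by rewrite bc eqxx in cb.
- have := cP (b + m - c)%N; have := bP (c - b)%N.
  by rewrite !subnKC; have := ltn_ord b; have := ltn_ord c; lia.
- have := bP (c + m - b)%N; have := cP (b - c)%N.
  by rewrite !subnKC; have := ltn_ord b; have := ltn_ord c; lia.
Qed.

(** The rotation of [0, ..., m - 1] that brings [b] to [0]; it fixes the last point [m]. *)
Definition rot_fun (m b : nat) (x : 'I_m.+1) : 'I_m.+1 :=
  if x < b then inord (x + m - b) else if x < m then inord (x - b) else x.

Lemma rot_funE (m b : nat) (x : 'I_m.+1) :
  rot_fun b x =
  (if x < b then x + m - b else if x < m then x - b else x)%N :> nat.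
Proof.
have := ltn_ord x; rewrite /rot_fun.
by case: ifP => xb; [|case: ifP => xm //]; rewrite inordK //; lia.
Qed.

Lemma rot_fun_inj (m b : nat) : b < m -> injective (@rot_fun m b).
Proof.
move=> bm x y /(congr1 val) /=; rewrite !rot_funE => xy; apply/val_inj => /=.
by have := ltn_ord x; have := ltn_ord y; move: xy; do !case: ifP; lia.
Qed.

Definition rot_perm (m : nat) (b : 'I_m) : {perm 'I_m.+1} :=
  perm (rot_fun_inj (ltn_ord b)).

Definition preference_condition {n : nat} (pi : {ffun 'I_n -> 'I_n}) : bool :=
  [forall j : 'I_n, (0 < j) ==> (j < #|[set i | pi i < j]|)].

Definition not_last (m : nat) : {set 'I_m.+1} := [set x : 'I_m.+1 | x < m].

Lemma rot_perm_not_last (m : nat) (b : 'I_m) :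
  rot_perm b @: not_last m = not_last m.
Proof.
apply/eqP; rewrite eqEcard card_imset ?leqnn ?andbT; last exact: perm_inj.
apply/subsetP => _ /imsetP[x + ->]; rewrite !inE permE rot_funE => xm.
by have := ltn_ord b; do !case: ifP; lia.
Qed.

Lemma sum_preference_condition (m : nat) (f : {ffun 'I_m.+1 -> 'I_m.+1}) :
  0 < m -> (forall x, f x < m) ->
  (\sum_(b < m) preference_condition (conj_fun (rot_perm b) f) = 1)%N.
Proof.
move=> m0 fm.
(* The fibre sizes of [f], extended periodically, and their partial sums [G]. *)
pose c i := #|[set x | f x == i %% m :> nat]|.
pose G N := (\sum_(i < N) c i)%N.
have GS N : G N.+1 = (G N + c N)%N by rewrite /G big_ord_recr.
have cm i : c (i + m)%N = c i by rewrite /c modnDr.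
rewrite -(@cycle_lemma m G) //; last first.
  elim=> [|N IHN]; last first.
    by rewrite addSn !GS IHN cm; lia.
  rewrite /G add0n big_ord0 add0n -[RHS](card_ord m.+1) -sum1_card.
  transitivity (\sum_(i < m) \sum_(x : 'I_m.+1) (f x == i :> nat))%N.
    apply: eq_bigr => i _; rewrite /c modn_small // -sum1dep_card big_mkcond /=.
    by apply: eq_bigr => x _; case: ifP.
  rewrite exchange_big /=; apply: eq_bigr => x _.
  rewrite (bigD1 (Ordinal (fm x))) //= eqxx big1 // => i.
  by rewrite -val_eqE /= eq_sym => /negPf->.
apply: eq_bigr => b _; congr nat_of_bool.
apply: eq_forallb => j; case: (posnP j) => //= j0.
(* Conjugation also renames the arguments, which does not change the size of a preimage. *)
have -> : #|[set i | conj_fun (rot_perm b) f i < j]| =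
    #|[set x | rot_fun b (f x) < j]|.
  rewrite -[RHS](card_imset _ (@perm_inj _ (rot_perm b))); apply: eq_card => y.
  rewrite -[y](permKV (rot_perm b)) mem_imset; last exact: perm_inj.
  by rewrite !inE conj_funE permE.
(* The values rotated below [j] form the cyclic window of length [j] starting at [b]. *)
suff -> : (G (b + j) = G b + #|[set x | rot_fun b (f x) < j]|)%N.
  by rewrite ltn_add2l.
have: j <= m by rewrite -ltnS.
elim: (nat_of_ord j) => [|k IHk] km.
  by rewrite addn0 (_ : [set x | _] = set0) ?cards0 ?addn0 //.
rewrite addnS GS IHk 1?ltnW // -addnA; congr (_ + _)%N.
rewrite -[RHS](cardsID [set x | rot_fun b (f x) < k]).
congr (_ + _)%N; apply: eq_card => x; rewrite !inE.
  by apply/idP/andP => [xk|[]//]; rewrite ltnS ltnW.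
have -> : ((b + k) %% m = if b + k < m then b + k else b + k - m)%N.
  case: ltnP => bk; first by rewrite modn_small.
  by rewrite -{1}(subnK bk) modnDr modn_small //; have := ltn_ord b; lia.
rewrite rot_funE; have := fm x; have := ltn_ord b.
by do !case: ifP; lia.
Qed.

(** * Parking *)

Lemma first_availableP (n : nat) (occ : {set 'I_n}) (p q : 'I_n) :
  p <= q -> q \notin occ -> exists r, first_available occ p r.
Proof.
move=> pq qocc.
case: (@arg_minnP _ q [pred r : 'I_n | (p <= r) && (r \notin occ)] val) => /=.
  by rewrite pq.
move=> r /andP[pr rocc] rmin; exists r; rewrite /first_available pr rocc /=.
apply/forallP => x; apply/implyP => /andP[px xr]; apply: contraLR xr => xocc.
by rewrite -leqNgt rmin // px.
Qed.

(* Cars preferring a space before j never park beyond a space j - 1 that is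
   still free; so if the car preferring p finds no free space, the block of
   taken spaces ending at n is preferred by more cars than its length. *)
Lemma all_park_counting (n : nat) (occ : {set 'I_n}) (t s : seq 'I_n) :
  (forall j, j < n -> count (fun x : 'I_n => j <= x) (t ++ s) <= n - j) ->
  (forall j, (forall r : 'I_n, r.+1 = j -> r \notin occ) ->
    #|[set q in occ | j <= q]| <= count (fun x : 'I_n => j <= x) t) ->
  all_park occ s.
Proof.
elim: s t occ => [//|p s IHs] t occ cnt inv /=; case: pickP => [q|none].
  case/and3P=> pq qocc /forallP between.
  apply: (IHs (rcons t p)) => [j jn|j jfree]; first by rewrite cat_rcons cnt.
  have jocc (r : 'I_n) : r.+1 = j -> r \notin occ.
    by move=> /jfree; rewrite !inE negb_or => /andP[].
  rewrite -cats1 count_cat /= addn0.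
  rewrite (cardsD1 q) !inE eqxx /= addnC leq_add //.
    apply: leq_trans (inv j jocc); apply/subset_leq_card/subsetP => x.
    by rewrite !inE => /and3P[/negPf-> /= -> ->].
  (* If [p < j <= q], then space [j - 1] was skipped by the car and hence taken, although it is
     assumed free. *)
  case: (leqP j q) => // jq; case: (leqP j p) => // pj.
  have j0 : 0 < j by apply: leq_ltn_trans pj.
  have jn : j.-1 < n by have := ltn_ord q; lia.
  have /negP[] := jocc (Ordinal jn) (prednK j0).
  by move/implyP: (between (Ordinal jn)); apply=> /=; lia.
(* For the least [j] with all spaces from [j] on taken, [j] is [0] or space [j - 1] is free. The
   invariant then yields [n - j] earlier cars preferring such spaces, and the car preferring [p] is
   one too many. *)
pose full j := [forall q : 'I_n, (j <= q) ==> (q \in occ)].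
have fullp : full p.
  apply/forallP => q; apply/implyP => pq; apply: contraT => qocc.
  by have [r] := first_availableP pq qocc; rewrite none.
have exf : exists j, full j by exists p.
case: (ex_minnP exf) => j /forallP fullj jmin.
have jp : j <= p by exact: jmin.
have jn : j < n by apply: leq_ltn_trans jp (ltn_ord p).
have jfree (r : 'I_n) : r.+1 = j -> r \notin occ.
  move=> rj; apply/negP => rocc; suff /jmin : full r by rewrite -rj ltnn.
  apply/forallP => q; apply/implyP.
  rewrite leq_eqVlt => /predU1P[/val_inj <-//|].
  by rewrite rj; apply/implyP.
have := cnt j jn; have := inv j jfree; rewrite count_cat /= jp.
suff -> : #|[set q in occ | j <= q]| = (n - j)%N by lia.
have -> : [set q in occ | j <= q] = ~: [set q : 'I_n | q < j].
  apply/setP => q; rewrite !inE -leqNgt andb_idl //; exact/implyP.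
rewrite cardsCs setCK card_ord; congr (_ - _)%N.
rewrite -sum1dep_card -(big_ord_widen _ (fun=> 1%N) (ltnW jn)) sum_nat_const.
by rewrite card_ord muln1.
Qed.

(** For [j > 0], more than [j] preferences below [j] leave fewer than [n - j] from [j] on; for
    [j = 0] the bound is the number of cars. *)
Lemma preference_condition_park (n : nat) (pi : {ffun 'I_n -> 'I_n}) :
  preference_condition pi -> parking_function pi.
Proof.
move=> /forallP pc.
apply: (@all_park_counting _ _ [::]) => [j jn|j _]; last first.
  rewrite (_ : [set q in _ | _] = set0) ?cards0 //.
  by apply/setP => x; rewrite !inE.
rewrite cat0s count_map.
have := count_predC (fun i => pi i < j) (enum 'I_n).
rewrite size_enum_ord.
have -> : count (predC (fun i => pi i < j)) (enum 'I_n) =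
    count (preim pi (fun x : 'I_n => j <= x)) (enum 'I_n).
  by apply: eq_count => i; rewrite /= -leqNgt.
have -> : count (fun i => pi i < j) (enum 'I_n) = #|[set i | pi i < j]|.
  by rewrite cardsE cardE -size_filter enumT.
move: (pc (Ordinal jn)) => /= pj cE; move: cE pj.
set N := #|_|; set M := count _ _; set M' := (X in _ -> _ -> X <= _).
have -> : M' = M by [].
by case: (posnP j) => [->|_] /=; lia.
Qed.

Lemma prime_parking_functionE (n : nat) (pi : {ffun 'I_n -> 'I_n}) :
  prime_parking_function pi = preference_condition pi.
Proof. by rewrite [LHS]andb_idl //; apply: preference_condition_park. Qed.

(** * Counting prime parking functions by cycle type *)

(** The vertex sets of the cycles of length [i] partition the cyclic points of order [i] into blocks
    of size [i]. *)
Lemma card_cycles_of_length (n : nat) (pi : {ffun 'I_n -> 'I_n}) (i : nat) :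
  0 < i -> #|cyclic_points pi setT i| = (i * #|cycles_of_length pi i|)%N.
Proof.
move=> i0.
have cycP A : reflect (exists c : seq 'I_n,
    [/\ fcycle pi c, uniq c, size c = i & A = [set x in c]])
    (A \in cycles_of_length pi i).
  have cE (c : seq 'I_n) : cycle (pf_digraph pi) c = fcycle pi c.
    by apply: eq_cycle => x y; rewrite /= eq_sym.
  apply: (iffP imsetP) => [[c]|[c [fc uc sc ->]]].
    rewrite inE /ucycleb cE => /andP[fc uc] ->.
    by exists c; rewrite fc uc size_tuple.
  by exists (Tuple (introT eqP sc)); rewrite // inE /ucycleb cE fc.
rewrite mulnC; apply: card_uniform_partition.
  by move=> A /cycP[c [_ uc sc ->]]; rewrite cardsE (card_uniqP uc).
apply/and3P; split.
- apply/eqP/setP => x; apply/bigcupP/idP.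
    case=> A /cycP[c [fc uc sc ->]]; rewrite !inE => xc.
    by rewrite (fcycle_cyclic fc xc) (order_cycle fc) // sc /=.
  rewrite !inE /= => /andP[cx /eqP ox]; exists [set y in orbit pi x].
    apply/cycP; exists (orbit pi x).
    by rewrite -fconnect_f cx orbit_uniq size_orbit ox.
  by rewrite inE in_orbit.
- apply/trivIsetP => A B /cycP[c [fc _ _ ->]] /cycP[d [fd _ _ ->]].
  apply: contraNT => /pred0Pn[x /=]; rewrite !inE => /andP[xc xd].
  apply/eqP/setP => y; rewrite !inE.
  by rewrite -(fconnect_cycle fc xc) (fconnect_cycle fd xd).
- apply/negP => /cycP[c [_ uc sc /esym c0]].
  by move: i0; rewrite -sc -(card_uniqP uc) -cardsE c0 cards0.
Qed.

Lemma conj_maps_of_type (V : finType) (p : {perm V}) (W U : {set V}) (n : nat)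
    (ks : nat -> nat) (f : {ffun V -> V}) :
  (conj_fun p f \in maps_of_type (p @: W) (p @: U) n ks) =
  (f \in maps_of_type W U n ks).
Proof.
rewrite [LHS]inE [RHS]inE conj_maps; congr (_ && _).
apply: eq_forallb => i; rewrite cyclic_points_conj card_imset //.
exact: perm_inj.
Qed.

(** Pairs of a map and a rotation making it prime are counted twice: each map has one such rotation,
    and each rotation permutes the maps of the given type. *)
Lemma card_prime_maps_of_type (m n : nat) (ks : nat -> nat) :
  0 < m ->
  (m * #|[set f in maps_of_type (not_last m) setT n ks |
           preference_condition f]|
    = #|maps_of_type (not_last m) setT n ks|)%N.
Proof.
move=> m0; set F := maps_of_type _ _ _ _.
rewrite -[RHS]sum1_card.
transitivity (\sum_(f in F) \sum_(b < m)
    preference_condition (conj_fun (rot_perm b) f))%N; last first.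
  apply: eq_bigr => f /maps_of_typeP[/mapsP[fW _] _].
  by apply: sum_preference_condition => // x; have := fW x; rewrite !inE; apply.
rewrite exchange_big /=.
transitivity (\sum_(b < m) #|[set f in F | preference_condition f]|)%N.
  by rewrite sum_nat_const card_ord.
apply: eq_bigr => b _; rewrite -sum1dep_card big_mkcondr /=.
have FE f : (conj_fun (rot_perm b) f \in F) = (f \in F).
  rewrite /F -[RHS](conj_maps_of_type (rot_perm b)) rot_perm_not_last.
  suff -> : rot_perm b @: setT = setT by []; apply/setP => x.
  by rewrite -[x](permKV (rot_perm b)) mem_imset ?inE //; apply: perm_inj.
rewrite (reindex (conj_fun (rot_perm b))) /=; last first.
  apply: onW_bij; exists (conj_fun (rot_perm b)^-1%g); first exact: conj_funK.
  exact: conj_funVK.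
by apply: eq_big => f; rewrite ?FE // => _; case: ifP.
Qed.

(** The inequality at [j = m] already involves all [m.+1] cars. *)
Lemma preference_condition_not_last (m : nat) (f : {ffun 'I_m.+1 -> 'I_m.+1}) :
  0 < m -> preference_condition f -> forall x, f x < m.
Proof.
move=> m0 /forallP/(_ ord_max); rewrite /= m0 /= => mlt x.
suff : x \in [set i | f i < m] by rewrite inE.
suff -> : [set i | f i < m] = setT by rewrite inE.
by apply/eqP; rewrite eqEcard subsetT cardsT card_ord.
Qed.

(** One factor of [m ^ 2] comes from the rotations, the other from the forest count. With [U = setT]
    there are no roots at the start. *)
Lemma card_prime_parking_function (m : nat) (ks : nat -> nat)
    (k := \sum_(i < m.+1 | 0 < i) i * ks i) :
  0 < m ->
  (#|[set pi : {ffun 'I_m.+1 -> 'I_m.+1} | prime_parking_function pi &&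
      [forall i : 'I_m.+1, (0 < i) ==> (#|cycles_of_length pi i| == ks i)]]|
    * (\prod_(i < m.+1 | 0 < i) (i ^ ks i * (ks i)`!)) * m ^ 2
    = m ^_ k * k * m ^ (m.+1 - k))%N.
Proof.
move=> m0.
have -> : [set pi : {ffun 'I_m.+1 -> 'I_m.+1} | prime_parking_function pi &&
      [forall i : 'I_m.+1, (0 < i) ==> (#|cycles_of_length pi i| == ks i)]] =
    [set f in maps_of_type (not_last m) setT m.+1 ks | preference_condition f].
  apply/setP => f; rewrite inE prime_parking_functionE [RHS]inE andbC.
  apply: andb_id2r => pc; rewrite [RHS]inE.
  have -> : f \in maps (not_last m) setT.
    apply/mapsP; split=> x; rewrite !inE // => _.
    exact: preference_condition_not_last.
  apply: eq_forallb => i; case: (posnP i) => //= i0.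
  by rewrite card_cycles_of_length // eqn_pmul2l.
have cW : #|not_last m| = m.
  rewrite -sum1dep_card -(big_ord_widen _ (fun=> 1%N) (leqnSn m)).
  by rewrite sum_nat_const card_ord muln1.
have /= := @card_maps_of_type _ (not_last m) setT m.+1 ks.
rewrite cW ltnSn setTI setDT cW cards0 add0n cardsT card_ord => /(_ isT).
rewrite -card_prime_maps_of_type // => <-; rewrite /k; ring.
Qed.

Local Open Scope ring_scope.

Theorem theorem25 (n k : nat) (ks : nat -> nat) (hn : (1 <= n)%N)
    (hk : k = (\sum_(1 <= i < n) i * ks i)%N)
    (hk1n : (1 <= k <= n - 1)%N) :
  #|[set pi : {ffun 'I_n -> 'I_n} | prime_parking_function pi &&
      [forall i : 'I_n, (0 < i)%N ==> (#|cycles_of_length pi i| == ks i)]]|%:R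
  = (\prod_(1 <= i < n) (i ^ ks i * (ks i)`!)%N)%:R^-1
    * 'C(n - 1, k)%:R * k`!%:R * k%:R
    * (n - 1)%:R ^ (n%:Z - k%:Z - 2) :> rat.
Proof.
case: n hn hk hk1n => [//|m] _ + /andP[k0]; rewrite subn1 /= => hk km.
have m0 : (0 < m)%N by apply: leq_trans km.
have mR0 : m%:R != 0 :> rat by rewrite pnatr_eq0 -lt0n.
have := card_prime_parking_function ks m0.
set S := #|_|; set P := (\prod_(i < _ | _) _)%N.
have -> : (\prod_(1 <= i < m.+1) (i ^ ks i * (ks i)`!) = P)%N.
  by rewrite big_geq_mkord.
have -> : (\sum_(i < m.+1 | 0 < i) i * ks i = k)%N by rewrite hk big_geq_mkord.
have P0 : P%:R != 0 :> rat.
  rewrite pnatr_eq0 -lt0n; apply: prodn_cond_gt0 => j j0.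
  by rewrite muln_gt0 expn_gt0 j0 fact_gt0.
move/(congr1 (fun x => x%:R : rat)).
rewrite -bin_ffact !natrM !natrX => E.
(* The exponent is [-1] when [k = m], so it is split into a natural power and a division. *)
have -> : m%:R ^ (m.+1%:Z - k%:Z - 2) = m%:R ^+ (m.+1 - k) / m%:R ^+ 2 :> rat.
  by rewrite subzn ?expfzDr //; apply: leqW.
apply: (mulIf (expf_neq0 2 mR0)); apply: (mulIf P0).
rewrite mulrAC E; field.
by rewrite P0 mR0.
Qed.
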